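(* The Gelfand-Tsetlin variety $\mathfrak{G}\subset\Bbbk^{18}$ for $Y_2(\mathfrak{gl}_3)$ is equidimensional with $\dim\mathfrak{G}=6$.
   Context: $\Bbbk$ is an algebraically closed field of characteristic zero. A variety is the zero set $V(S)$ in affine space of a set $S$ of polynomials; it is equidimensional if all its irreducible components have the same dimension. For integers $n,p\ge1$, the associated graded algebra of the restricted Yangian $Y_p(\mathfrak{gl}_n)$ of level $p$ is the polynomial algebra in the variables $X_{ij}^{(k)}$, $1\le i,j\le n$, $1\le k\le p$, which are taken as coordinates on $\Bbbk^{n^2p}$. Put $X_{ij}(u)=\delta_{ij}u^p+\sum_{k=1}^pX_{ij}^{(k)}u^{p-k}$. For $1\le m\le n$ define polynomials $\overline{d}_{mj}$, $1\le j\le mp$, by $$\det\left(X_{ij}(u)\right)_{i,j=1}^m=u^{mp}+\overline{d}_{m1}u^{mp-1}+\cdots+\overline{d}_{m,mp}$$ (these are the graded images of the coefficients of the quantum determinants of $Y_p(\mathfrak{gl}_m)$, which generate the Gelfand-Tsetlin subalgebra). The Gelfand-Tsetlin variety for $Y_p(\mathfrak{gl}_n)$ is $$\mathfrak{G}:=V\left(\{\overline{d}_{ij}\}_{1\le i\le n,\ 1\le j\le ip}\right)\subset\Bbbk^{n^2p}.$$ Here $p=2$ and $n=3$. *)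

(* Defs.v *)
From mathcomp Require Import all_boot all_order all_algebra.
From mathcomp Require Import classical_sets mpoly.

Set Implicit Arguments.
Unset Strict Implicit.
Unset Printing Implicit Defensive.

Import GRing.Theory.
Local Open Scope ring_scope.
Local Open Scope classical_set_scope.

Definition zero_locus (k : closedFieldType) (N : nat)
    (S : set {mpoly k[N]}) : set 'rV[k]_N :=
  [set x | forall f, S f -> f.@[x 0] = 0].

Definition zariski_closed (k : closedFieldType) (N : nat)
    (Z : set 'rV[k]_N) : Prop :=
  exists S : set {mpoly k[N]}, Z = zero_locus S.

Definition irreducible_closed (k : closedFieldType) (N : nat)
    (Z : set 'rV[k]_N) : Prop :=
  [/\ zariski_closed Z, Z !=set0 &
      forall A B : set 'rV[k]_N, zariski_closed A -> zariski_closed B ->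
        Z = A `|` B -> Z = A \/ Z = B].

Definition irreducible_component (k : closedFieldType) (N : nat)
    (Z C : set 'rV[k]_N) : Prop :=
  [/\ irreducible_closed C, C `<=` Z &
      forall D : set 'rV[k]_N,
        irreducible_closed D -> D `<=` Z -> C `<=` D -> D = C].

(* C 0 < C 1 < ... < C d; the values of C beyond d are irrelevant. *)
Definition has_irreducible_chain (k : closedFieldType) (N : nat)
    (Z : set 'rV[k]_N) (d : nat) : Prop :=
  exists C : nat -> set 'rV[k]_N,
    (forall i, (i <= d)%N -> irreducible_closed (C i) /\ C i `<=` Z) /\
    (forall i, (i < d)%N -> C i `<` C i.+1).

(* Krull dimension of a Zariski closed set, as a relation: the empty set has
   no dimension. *)
Definition has_dimension (k : closedFieldType) (N : nat)
    (Z : set 'rV[k]_N) (d : nat) : Prop :=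
  has_irreducible_chain Z d /\
  forall e, has_irreducible_chain Z e -> (e <= d)%N.

Definition equidimensional (k : closedFieldType) (N : nat)
    (Z : set 'rV[k]_N) : Prop :=
  exists d, forall C, irreducible_component Z C -> has_dimension C d.

(* The coordinate $X_{ij}^{(r+1)}$, for i, j, r counted from 0. *)
Definition yangian_var (k : closedFieldType) (n p : nat)
    (i j : 'I_n) (r : 'I_p) : {mpoly k[n * n * p]} :=
  'X_(mxvec_index (mxvec_index i j) r).

(* The matrix $(X_{ij}(u))$; the polynomial variable is u. *)
Definition yangian_mx (k : closedFieldType) (n p : nat) :
    'M[{poly {mpoly k[n * n * p]}}]_n :=
  \matrix_(i, j) ((i == j)%:R * 'X^p +
    \sum_(r < p) (yangian_var k i j r)%:P * 'X^(p - r.+1)).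

(* The leading principal minor of size m + 1. *)
Definition leading_minor (k : closedFieldType) (n p : nat) (m : 'I_n) :
    {poly {mpoly k[n * n * p]}} :=
  \det (\matrix_(i < m.+1, j < m.+1)
    yangian_mx k n p (widen_ord (ltn_ord m) i) (widen_ord (ltn_ord m) j)).

(* $\overline{d}_{m+1,j}$ *)
Definition dbar (k : closedFieldType) (n p : nat) (m : 'I_n) (j : nat) :
    {mpoly k[n * n * p]} :=
  (leading_minor k p m)`_(m.+1 * p - j).

Definition gelfand_tsetlin_variety (k : closedFieldType) (n p : nat) :
    set 'rV[k]_(n * n * p) :=
  zero_locus [set f | exists (m : 'I_n) (j : nat),
    (1 <= j <= m.+1 * p)%N /\ f = dbar k p m j].

Arguments gelfand_tsetlin_variety k n p : clear implicits.

(* Main.v *)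
(* Write X_12 = a u + b, X_21 = c u + d, X_13 = x, X_31 = z, X_23 = y, X_32 = w.
   The equations force bd = ad + bc = 0, X_22 = u^2 + ac, determine X_11 and
   X_33, and leave four relations, namely the vanishing modulo u^4 of
     z x (u^2 + ac) - z X_12 y - w X_21 x + u^2 w y.
   If b = d = 0 this is u^2 z x + (a z - u w) (c x - u y). Splitting according to
   which of b, d, x(0), z(0), a, c vanish, every stratum turns out to lie in the
   image of a polynomial map from the affine 6-space into the variety, so no
   closure relation between strata (and no height theorem) is needed.

   Such a union of images of k^n is equidimensional of dimension n. The image of
   a flag of coordinate subspaces gives a chain of length n in the closure of
   each image. Conversely a chain of length e yields e functions whose D^e
   monomials with exponents < D are linearly independent, while polynomials of
   degree O(D) span a space of dimension O(D^n) on a finite union of images of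
   k^n; hence e <= n. *)
Require Import Defs.
From mathcomp Require Import all_boot all_order all_algebra.
From mathcomp Require Import boolp classical_sets mpoly ring zify.

Local Open Scope ring_scope.

Section GelfandTsetlin.

Set Implicit Arguments.
Unset Strict Implicit.
Unset Printing Implicit Defensive.
Import GRing.Theory.
Local Open Scope classical_set_scope.

Variable k : closedFieldType.

(** * Vanishing ideals, Zariski closure and irreducibility *)

Definition vanishing (N : nat) (X : set 'rV[k]_N) : set {mpoly k[N]} :=
  [set f | forall x, X x -> f.@[x 0] = 0].

Definition closure (N : nat) (X : set 'rV[k]_N) := zero_locus (vanishing X).

(** Phrased for arbitrary subsets because images of polynomial maps need not be closed. Nonemptiness
    excludes the unit ideal. *)
Definition prime_set (N : nat) (X : set 'rV[k]_N) : Prop :=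
  X !=set0 /\
  forall f g, vanishing X (f * g) -> vanishing X f \/ vanishing X g.

Lemma sub_closure N (X : set 'rV[k]_N) : X `<=` closure X.
Proof. by move=> x Xx f; apply. Qed.

Lemma zariski_closed_closure N (X : set 'rV[k]_N) : zariski_closed (closure X).
Proof. by exists (vanishing X). Qed.

Lemma vanishing_sub N (X Y : set 'rV[k]_N) :
  X `<=` Y -> vanishing Y `<=` vanishing X.
Proof. by move=> sXY f Yf x /sXY /Yf. Qed.

Lemma vanishing_closure N (X : set 'rV[k]_N) :
  vanishing (closure X) = vanishing X.
Proof.
apply/seteqP; split; first exact/vanishing_sub/sub_closure.
by move=> f Xf x; apply.
Qed.

Lemma closure_min N (X W : set 'rV[k]_N) :
  zariski_closed W -> X `<=` W -> closure X `<=` W.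
Proof.
move=> [S ->] sXW x Xx f Sf; apply: Xx => y /sXW; exact.
Qed.

Lemma closureS N (X Y : set 'rV[k]_N) : X `<=` Y -> closure X `<=` closure Y.
Proof.
move=> sXY; apply: closure_min; first exact: zariski_closed_closure.
exact/(subset_trans sXY)/sub_closure.
Qed.

Lemma closed_separation N (W : set 'rV[k]_N) x :
  zariski_closed W -> ~ W x -> exists2 f, vanishing W f & f.@[x 0] <> 0.
Proof.
move=> [S ->] /existsNP [f /not_implyP [Sf fx]]; exists f => // y; exact.
Qed.

(** If neither [A] nor [B] contains [X], a function vanishing on [A] but not on [X], times one
    vanishing on [B] but not on [X], vanishes on [X], against primality. *)
Lemma irreducible_closure N (X : set 'rV[k]_N) :
  prime_set X -> irreducible_closed (closure X).
Proof.
move=> [[x0 Xx0] Xprime]; split.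
- exact: zariski_closed_closure.
- by exists x0; apply: sub_closure.
move=> A B Acl Bcl XAB.
have [sXA|/existsNP [x /not_implyP [Xx Ax]]] := pselect (X `<=` A).
  left; apply/seteqP; split; first exact: closure_min.
  by rewrite XAB; apply: subsetUl.
have [sXB|/existsNP [y /not_implyP [Xy By]]] := pselect (X `<=` B).
  right; apply/seteqP; split; first exact: closure_min.
  by rewrite XAB; apply: subsetUr.
have [f Af fx] := closed_separation Acl Ax.
have [g Bg gy] := closed_separation Bcl By.
have [z Xz|/(_ _ Xx)//|/(_ _ Xy)//] := Xprime f g.
have : closure X z by apply: sub_closure.
by rewrite XAB mevalM => -[/Af|/Bg] ->; rewrite ?mul0r ?mulr0.
Qed.

Lemma zariski_closedI1 N (C : set 'rV[k]_N) f :
  zariski_closed C -> zariski_closed (C `&` [set x | f.@[x 0] = 0]).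
Proof.
move=> [S ->]; exists (S `|` [set f]); apply/seteqP; split=> x /=.
  by move=> [Sx fx] g [/Sx//|->].
by move=> H; split; [move=> g Sg; apply: H; left | apply: H; right].
Qed.

Lemma irreducible_prime N (C : set 'rV[k]_N) :
  irreducible_closed C -> prime_set C.
Proof.
move=> [Ccl C0 Cirr]; split=> // f g fg.
have [|E|E] := Cirr _ _ (zariski_closedI1 f Ccl) (zariski_closedI1 g Ccl).
- apply/seteqP; split=> x; last by move=> [[]|[]].
  move=> Cx; have /eqP := fg _ Cx.
  by rewrite mevalM mulf_eq0 => /orP[/eqP ?|/eqP ?]; [left|right].
- by left=> x; rewrite E => -[].
- by right=> x; rewrite E => -[].
Qed.

(** By contraposition: multiplying functions that vanish on the successive [Z i] but not on [C]
    gives, by primality, one function vanishing on every [Z i] but not on [C]. *)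
Lemma irreducible_sub_bigcup N (C : set 'rV[k]_N) (I : eqType) (s : seq I)
    (Z : I -> set 'rV[k]_N) :
  irreducible_closed C -> (forall i, i \in s -> zariski_closed (Z i)) ->
  (forall x, C x -> exists2 i, i \in s & Z i x) ->
  exists2 i, i \in s & C `<=` Z i.
Proof.
move=> /irreducible_prime [[x0 Cx0] Cprime] Zcl.
suff : ~ (exists2 i, i \in s & C `<=` Z i) ->
    exists2 f, forall i, i \in s -> vanishing (Z i) f & ~ vanishing C f.
  move=> H Ccov; apply: contrapT => /H [f fZ []] x /Ccov [i si Zx].
  exact: fZ Zx.
elim: s Zcl => [|i s IH] Zcl nC.
  by exists 1 => // /(_ _ Cx0); rewrite meval1; apply/eqP/oner_neq0.
have [||f fZ fC] := IH.
- by move=> j js; apply: Zcl; rewrite in_cons js orbT.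
- by move=> [j js CZ]; apply: nC; exists j; rewrite // in_cons js orbT.
have [sCZ|/existsNP [x /not_implyP [Cx Zx]]] := pselect (C `<=` Z i).
  by case: nC; exists i; rewrite // mem_head.
have [|g gZ gx] := closed_separation _ Zx.
  by apply: Zcl; rewrite mem_head.
exists (f * g).
  move=> j; rewrite in_cons => /orP[/eqP ->|js] y Zy; rewrite mevalM.
    by rewrite gZ ?mulr0.
  by rewrite (fZ j) ?mul0r.
by move=> /Cprime [//|/(_ _ Cx)].
Qed.

(** * Polynomial maps *)

Definition polymap (n N : nat) (phi : 'rV[{mpoly k[n]}]_N) (v : 'I_n -> k) :
    'rV[k]_N :=
  \row_j (phi 0 j).@[v].

Definition components (n N : nat) (phi : 'rV[{mpoly k[n]}]_N) :
    N.-tuple {mpoly k[n]} :=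
  [tuple phi 0 j | j < N].

Lemma meval_polymap n N (phi : 'rV[{mpoly k[n]}]_N) v f :
  f.@[polymap phi v 0] = (f \mPo components phi).@[v].
Proof.
by rewrite comp_mpoly_meval; apply: meval_eq => j; rewrite tnth_mktuple mxE.
Qed.

Lemma meval_line n (s t : 'I_n -> k) (p : {mpoly k[n]}) :
  exists q : {poly k},
    forall a, q.[a] = p.@[fun i => s i + a * (t i - s i)].
Proof.
exists (mmap polyC (fun i => (s i)%:P + 'X * (t i - s i)%:P) p) => a.
rewrite mevalE /mmap horner_sum; apply: eq_bigr => m _.
rewrite hornerM hornerC horner_prod; congr (_ * _); apply: eq_bigr => i _.
by rewrite horner_exp !hornerE.
Qed.

(* On the line through a non-zero of f and a non-zero of g, both restrict to
   nonzero univariate polynomials, whose product has a non-root. *)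
Lemma prime_image n N (phi : 'rV[{mpoly k[n]}]_N) (V : set ('I_n -> k)) :
  V !=set0 ->
  (forall s t a, V s -> V t -> V (fun i => s i + a * (t i - s i))) ->
  prime_set (polymap phi @` V).
Proof.
move=> [v0 Vv0] Vline; split; first by exists (polymap phi v0); exists v0.
move=> f g fg; apply: contrapT => /not_orP.
move=> [/existsNP [_ /not_implyP [[s Vs <-] /eqP fs]]].
move=> /existsNP [_ /not_implyP [[t Vt <-] /eqP gt]].
move: fs gt; rewrite !meval_polymap => fs gt.
have [p pE] := meval_line s t (f \mPo components phi).
have [q qE] := meval_line s t (g \mPo components phi).
have p0 : p != 0.
  apply: contraNneq fs => p0; have := pE 0; rewrite p0 horner0 => ->.
  by apply/eqP/meval_eq => i; rewrite mul0r addr0.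
have q0 : q != 0.
  apply: contraNneq gt => q0; have := qE 1; rewrite q0 horner0 => ->.
  by apply/eqP/meval_eq => i; rewrite mul1r addrC subrK.
have [a] : exists a, ~~ root (p * q) a.
  by apply/closed_nonrootP; rewrite mulf_neq0.
rewrite rootE hornerM pE qE -!meval_polymap -mevalM fg ?eqxx //.
by eexists; first exact: Vline Vs Vt.
Qed.

Definition flag (n j : nat) : set ('I_n -> k) :=
  [set v | forall i : 'I_n, (j <= i)%N -> v i = 0].
Arguments flag : clear implicits.

Lemma flag_subset n i j : (i <= j)%N -> flag n i `<=` flag n j.
Proof. by move=> ij v vi l jl; apply: vi; apply: leq_trans jl. Qed.

Lemma prime_image_flag n N (phi : 'rV[{mpoly k[n]}]_N) j :
  prime_set (polymap phi @` flag n j).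
Proof.
apply: prime_image; first by exists (fun=> 0).
by move=> s t a Vs Vt i ji; rewrite Vs ?Vt // subr0 mulr0 addr0.
Qed.

(** Makes the closures of the images of successive coordinate subspaces distinct, hence links of a
    chain of length [n]. *)
Definition flag_strict n N (phi : 'rV[{mpoly k[n]}]_N) : Prop :=
  forall j, (j < n)%N -> exists2 f, vanishing (polymap phi @` flag n j) f
                                  & ~ vanishing (polymap phi @` flag n j.+1) f.

Lemma flagT n : flag n n = setT.
Proof. by apply/seteqP; split=> // v _ i; rewrite leqNgt ltn_ord. Qed.

Lemma irreducible_image n N (phi : 'rV[{mpoly k[n]}]_N) :
  irreducible_closed (closure (range (polymap phi))).
Proof.
by apply: irreducible_closure; rewrite -flagT; apply: prime_image_flag.
Qed.

Lemma chain_image n N (phi : 'rV[{mpoly k[n]}]_N) :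
  flag_strict phi -> has_irreducible_chain (closure (range (polymap phi))) n.
Proof.
move=> phi_strict; exists (fun j => closure (polymap phi @` flag n j)); split.
  move=> j _; split; first exact/irreducible_closure/prime_image_flag.
  by apply/closureS/image_subset.
move=> j jn; have [f f0 f1] := phi_strict j jn.
split; first by apply/closureS/image_subset/flag_subset.
by move=> /vanishing_sub/(_ f); rewrite !vanishing_closure => /(_ f0).
Qed.


(** * Counting polynomials of bounded degree *)

(** [msize] is the total degree plus one, and 0 at the zero polynomial, which thus satisfies every
    bound. *)
Definition deg_le (n d : nat) (p : {mpoly k[n]}) := (msize p <= d.+1)%N.

Lemma deg_le_trans n d e (p : {mpoly k[n]}) :
  (d <= e)%N -> deg_le d p -> deg_le e p.
Proof. by move=> de pd; apply: leq_trans pd _. Qed.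

Lemma deg_leM n d e (p q : {mpoly k[n]}) :
  deg_le d p -> deg_le e q -> deg_le (d + e) (p * q).
Proof.
rewrite /deg_le => pd qe.
have [->|p0] := eqVneq p 0; first by rewrite mul0r msize0.
have [->|q0] := eqVneq q 0; first by rewrite mulr0 msize0.
by rewrite msizeM //; move: (msize p) (msize q) pd qe => a b; lia.
Qed.

Lemma deg_leX n d m (p : {mpoly k[n]}) : deg_le d p -> deg_le (m * d) (p ^+ m).
Proof.
move=> pd; elim: m => [|m IH]; first by rewrite expr0 /deg_le msize1.
by rewrite exprS mulSn; apply: deg_leM.
Qed.

Lemma deg_le_prod n (I : Type) (r : seq I) (d : I -> nat)
    (F : I -> {mpoly k[n]}) :
  (forall i, deg_le (d i) (F i)) ->
  deg_le (\sum_(i <- r) d i) (\prod_(i <- r) F i).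
Proof.
move=> Fd; elim: r => [|i r IH]; first by rewrite !big_nil /deg_le msize1.
by rewrite !big_cons; apply: deg_leM.
Qed.

Lemma deg_le_sum n d (I : eqType) (r : seq I) (F : I -> {mpoly k[n]}) :
  (forall i, i \in r -> deg_le d (F i)) -> deg_le d (\sum_(i <- r) F i).
Proof.
move=> Fd; rewrite big_seq; elim/big_rec: _ => [|i p ir pd].
  by rewrite /deg_le msize0.
apply: leq_trans (mmeasureD_le _ _ _) _; rewrite geq_max.
by apply/andP; split; first exact: Fd.
Qed.

Lemma deg_leZ n d c (p : {mpoly k[n]}) : deg_le d p -> deg_le d (c *: p).
Proof. by move=> pd; apply: leq_trans (msizeZ_le _ _) pd. Qed.

Lemma deg_le_comp n m d B (p : {mpoly k[m]}) (q : m.-tuple {mpoly k[n]}) :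
  deg_le d p -> (forall i, deg_le B (tnth q i)) -> deg_le (d * B) (p \mPo q).
Proof.
move=> pd qB; rewrite comp_mpolyE; apply: deg_le_sum => u up; apply: deg_leZ.
apply: (@deg_le_trans _ (\sum_i u i * B)%N).
  rewrite -big_distrl -mdegE leq_mul2r; apply/orP; right.
  by have := leq_trans (msize_mdeg_lt up) pd.
by apply: deg_le_prod => i; apply: deg_leX.
Qed.

Lemma card_bmultinom n b : (#|{: 'X_{1..n < b}}| <= b ^ n)%N.
Proof.
have mb (m : 'X_{1..n < b}) (i : 'I_n) : (m i < b)%N.
  by apply: leq_ltn_trans (bmdeg m); rewrite mdegE (bigD1 i) //= leq_addr.
pose f (m : 'X_{1..n < b}) := [ffun i => Ordinal (mb m i)].
suff /leq_card : injective f by rewrite card_ffun !card_ord.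
move=> u v /ffunP uv; apply/val_inj/mnmP => i.
by have := uv i; rewrite !ffunE => /(congr1 val).
Qed.

(** More unknowns than equations: a nonzero solution lies in the left kernel of the matrix. *)
Lemma exists_dependency (T U : finType) (a : T -> U -> k) :
  (#|U| < #|T|)%N ->
  exists2 c : T -> k, exists t, c t != 0 & forall u, \sum_t c t * a t u = 0.
Proof.
move=> UT; pose A := \matrix_(i < #|T|, j < #|U|) a (enum_val i) (enum_val j).
have : kermx A != 0.
  rewrite -mxrank_eq0 mxrank_ker -lt0n subn_gt0.
  by apply: leq_ltn_trans UT; apply: rank_leq_col.
case/rowV0Pn => c /sub_kermxP cA c0.
exists (fun t => c 0 (enum_rank t)).
  move/rV0Pn: c0 => [i ci]; exists (enum_val i); by rewrite enum_valK.
move=> u; have /rowP/(_ (enum_rank u)) := cA.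
rewrite !mxE (reindex (@enum_rank T)) /=; last exact/onW_bij/enum_rank_bij.
by under eq_bigr do rewrite mxE !enum_rankK.
Qed.

(** * Bounding the length of chains *)

Definition independent_on N (X : set 'rV[k]_N) (T : finType)
    (F : T -> {mpoly k[N]}) : Prop :=
  forall c : T -> k, vanishing X (\sum_t c t *: F t) -> forall t, c t = 0.

(* Restrict to [Y], where [f] vanishes, to kill the constant term in [f]; then
   divide by [f] on the irreducible set [X] and repeat. *)
Lemma vanishing_expansion N (X Y : set 'rV[k]_N) f D (G : nat -> {mpoly k[N]}) :
  prime_set X -> Y `<=` X -> vanishing Y f -> ~ vanishing X f ->
  (forall q, vanishing Y (G q) -> G q = 0) ->
  vanishing X (\sum_(q < D) f ^+ q * G q) ->
  forall q, (q < D)%N -> G q = 0.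
Proof.
move=> [X0 Xprime] sYX Yf Xf; elim: D G => [|D IH] G G0 //.
rewrite big_ord_recl expr0 mul1r.
under eq_bigr do rewrite lift0 exprS -mulrA.
rewrite -mulr_sumr => GX.
have E0 : G 0%N = 0.
  apply: G0 => y Yy; have := GX _ (sYX _ Yy).
  by rewrite mevalD mevalM Yf // mul0r addr0.
move: GX; rewrite E0 add0r => /Xprime [//|GX] [|q] //; rewrite ltnS.
by apply: (IH (fun q => G q.+1)) => // r; apply: G0.
Qed.

(** Induction along the chain: a function [f] vanishing on [C e] but not on [C e.+1] contributes its
    powers below [D], multiplying the number of independent functions by [D]. [M] is chosen before
    [D], so that degrees grow only linearly in [D]. *)
Lemma chain_independent N (C : nat -> set 'rV[k]_N) e :
  (forall i, (i <= e)%N -> irreducible_closed (C i)) ->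
  (forall i, (i < e)%N -> C i `<` C i.+1) ->
  exists M, forall D, exists (T : finType) (F : T -> {mpoly k[N]}),
    [/\ #|T| = (D ^ e)%N, forall t, deg_le (D * M) (F t)
      & independent_on (C e) F].
Proof.
elim: e => [|e IH] Cirr Clt.
  exists 0%N => D; exists unit, (fun=> 1); split.
  - by rewrite card_unit.
  - by move=> _; rewrite /deg_le msize1.
  have [_ [x Cx] _] := Cirr 0%N isT.
  move=> c /(_ x Cx); rewrite (bigD1 tt) //= big1 ?addr0; last by case.
  by rewrite mevalZ meval1 mulr1 => c0 [].
have [||M HM] := IH.
- by move=> i ie; apply: Cirr; apply: leqW.
- by move=> i ie; apply: Clt; apply: leqW.
have [sC nsC] := Clt e (ltnSn e).
have [x Cx nCx] : exists2 x, C e.+1 x & ~ C e x.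
  by move/existsNP: nsC => [x /not_implyP []]; exists x.
have [Ccl _ _] := Cirr e (leqnSn e).
have [f fC fx] := closed_separation Ccl nCx.
have f1 : ~ vanishing (C e.+1) f by move/(_ x Cx).
exists (M + msize f)%N => D; have [T [F [cT dF indF]]] := HM D.
exists ('I_D * T)%type, (fun t : 'I_D * T => f ^+ t.1 * F t.2); split.
- by rewrite card_prod card_ord cT expnS.
- move=> [q t] /=; apply: (@deg_le_trans _ (q * msize f + D * M)%N).
    by rewrite mulnDr addnC leq_add2l leq_mul2r ltnW ?orbT.
  by apply: deg_leM => //; apply: deg_leX; rewrite /deg_le leqnSn.
move=> c cv.
(* [c] is extended by zero to all natural exponents, as [vanishing_expansion] takes a sequence
   indexed by [nat]. *)
pose d q t := if insub q is Some q' then c (q', t) else 0.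
pose G q := \sum_t d q t *: F t.
have GE : forall q, (q < D)%N -> G q = 0.
  apply: (vanishing_expansion (irreducible_prime (Cirr e.+1 _)) sC fC f1) => //.
    by move=> q /indF dq; rewrite /G big1 // => t _; rewrite dq scale0r.
  suff -> : \sum_(q < D) f ^+ q * G q =
      \sum_(t : 'I_D * T) c t *: (f ^+ t.1 * F t.2) by [].
  transitivity (\sum_(q < D) \sum_t c (q, t) *: (f ^+ q * F t)).
    apply: eq_bigr => q _; rewrite /G mulr_sumr; apply: eq_bigr => t _.
    by rewrite /d valK scalerAr.
  by rewrite pair_bigA; apply: eq_bigr => -[].
move=> [q t]; have <- : d q t = c (q, t) by rewrite /d valK.
by apply: indF => y _; rewrite -/(G q) GE ?meval0.
Qed.

(** A combination vanishes on the images once all coefficients of its pullbacks do. The pullbacks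
    have degree at most [d * B], which gives at most [size L * (d * B).+1 ^ n] linear conditions,
    fewer than the [#|T|] unknowns. *)
Lemma dependent_on_images N n (L : seq 'rV[{mpoly k[n]}]_N) B d (T : finType)
    (F : T -> {mpoly k[N]}) (X : set 'rV[k]_N) :
  (forall phi, phi \in L -> forall j, deg_le B (phi 0 j)) ->
  (forall x, X x -> exists2 phi, phi \in L & range (polymap phi) x) ->
  (forall t, deg_le d (F t)) ->
  (size L * (d * B).+1 ^ n < #|T|)%N -> ~ independent_on X F.
Proof.
move=> LB Lcov Fd lt_T indF.
pose U := ('I_(size L) * 'X_{1..n < (d * B).+1})%type.
pose a t (u : U) := (F t \mPo components L`_u.1)@_u.2.
have [|c [t ct] ca] := @exists_dependency T U a.
  apply: leq_ltn_trans lt_T.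
  by rewrite card_prod card_ord leq_mul2l card_bmultinom orbT.
apply/negP: ct; rewrite negbK; apply/eqP/indF => x /Lcov [phi phiL [v _ <-]].
rewrite meval_polymap.
have -> : (\sum_t c t *: F t) \mPo components phi =
    \sum_t c t *: (F t \mPo components phi).
  by rewrite linear_sum; apply: eq_bigr => u _; rewrite linearZ.
suff -> : \sum_t c t *: (F t \mPo components phi) = 0 by rewrite meval0.
apply/mpolyP => m; rewrite mcoeff0.
have [md|md] := ltnP (mdeg m) (d * B).+1; last first.
  apply/eqP; rewrite mcoeff_eq0; apply: msize_mdeg_ge; apply: leq_trans md.
  apply: deg_le_sum => u _; apply: deg_leZ.
  by apply: deg_le_comp => // i; rewrite tnth_mktuple; apply: LB.
have iL : (index phi L < size L)%N by rewrite index_mem.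
have := ca (Ordinal iL, BMultinom md); rewrite /a /= nth_index // => <-.
by rewrite raddf_sum; apply: eq_bigr => u _; exact: mcoeffZ.
Qed.

Lemma chain_in_images N n (L : seq 'rV[{mpoly k[n]}]_N) (X : set 'rV[k]_N) e :
  (forall x, X x -> exists2 phi, phi \in L & range (polymap phi) x) ->
  has_irreducible_chain X e -> (e <= n)%N.
Proof.
move=> Lcov [C [Cirr Clt]]; rewrite leqNgt; apply/negP => ne.
have [M HM] := chain_independent (fun i ie => (Cirr i ie).1) Clt.
pose B := \max_(phi <- L) \max_j msize (phi 0%R j).
have LB phi : phi \in L -> forall j, deg_le B (phi 0 j).
  move=> phiL j; apply: leqW; rewrite /B (big_rem _ phiL) /= leq_max.
  by apply/orP; left; apply: (leq_bigmax (F := fun j => msize (phi 0 j))).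
(* With this [K], [size L * (D * (M * B).+1) ^ n] equals [K * D ^ n], which for [D = K.+1] is less
   than [D ^ n.+1 <= D ^ e]. *)
pose K := ((M * B).+1 ^ n * size L)%N; pose D := K.+1.
have [T [F [cT dF indF]]] := HM D.
apply: (dependent_on_images LB _ dF _ indF).
  by move=> x /(Cirr e (leqnn e)).2; apply: Lcov.
rewrite cT; apply: (@leq_ltn_trans (size L * (D * (M * B).+1) ^ n)%N).
  rewrite leq_mul2l; apply/orP; right.
  have [->|n_gt0] := posnP n; first by rewrite !expn0.
  by rewrite leq_exp2r // mulnS -mulnA; lia.
apply: (@leq_trans (D ^ n.+1)%N); last by rewrite leq_pexp2l.
rewrite expnMn expnS mulnCA mulnC ltn_pmul2r ?expn_gt0 //.
by rewrite /D ltnS /K mulnC.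
Qed.

(** A component is irreducible and covered by the finitely many closures of images, so it lies in
    one of them and equals it by maximality. The flag gives a chain of length [n] there, and
    [chain_in_images] excludes longer ones. *)
Lemma equidimensional_of_images N n (L : seq 'rV[{mpoly k[n]}]_N)
    (Z : set 'rV[k]_N) :
  zariski_closed Z -> L != [::] ->
  (forall phi, phi \in L -> flag_strict phi /\ range (polymap phi) `<=` Z) ->
  (forall x, Z x -> exists2 phi, phi \in L & range (polymap phi) x) ->
  equidimensional Z /\ has_dimension Z n.
Proof.
move=> Zcl L0 LZ Lcov.
have upper X e : X `<=` Z -> has_irreducible_chain X e -> (e <= n)%N.
  by move=> XZ; apply: (chain_in_images (L := L)) => x /XZ; apply: Lcov.
split.
  exists n => C [Cirr sCZ Cmax].
  have [|x /sCZ /Lcov [phi phiL x_phi]|phi phiL sC] :=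
    irreducible_sub_bigcup (s := L)
      (Z := fun phi => closure (range (polymap phi))) Cirr.
  - by move=> phi _; apply: zariski_closed_closure.
  - by exists phi => //; apply: sub_closure.
  have [phi_strict phiZ] := LZ _ phiL.
  have <- : closure (range (polymap phi)) = C.
    by apply: Cmax => //; [apply: irreducible_image | apply: closure_min].
  split; first exact: chain_image.
  by move=> e; apply: upper; apply: closure_min.
split; last by move=> e; apply: upper.
case: L L0 LZ Lcov upper => [//|phi L] _ LZ _ _.
have [phi_strict phiZ] := LZ phi (mem_head _ _).
have [C [Cirr Clt]] := chain_image phi_strict.
exists C; split=> // i /Cirr [? CZ]; split=> //.
by apply: (subset_trans CZ); apply: closure_min.
Qed.


(** * Explicit equations *)

(* s lists X_ij^(1), X_ij^(2), row by row. *)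
Definition yangian_point (V : nmodType) (s : seq V) : 'rV[V]_(3 * 3 * 2) :=
  mxvec (\matrix_(q, r) mxvec (\matrix_(i, j) s`_(6 * i + 2 * j + r)) 0 q).

Lemma yangian_pointE (V : nmodType) (s : seq V) (i j : 'I_3) (r : 'I_2) :
  yangian_point s 0 (mxvec_index (mxvec_index i j) r) = s`_(6 * i + 2 * j + r).
Proof. by rewrite mxvecE mxE mxvecE mxE. Qed.

Lemma yangian_point_surj (V : nmodType) (x : 'rV[V]_(3 * 3 * 2)) :
  exists2 s, size s = 18 & x = yangian_point s.
Proof.
(* Inverts the flat position [m = 6 * i + 2 * j + r]. *)
pose c (m : nat) : V := x 0 (mxvec_index
  (mxvec_index (inord (m %/ 6) : 'I_3) (inord (m %% 6 %/ 2) : 'I_3))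
  (inord (m %% 2) : 'I_2)).
exists (mkseq c 18); first by rewrite size_mkseq.
apply/rowP; case/mxvec_indexP => q r; case/mxvec_indexP: q => i j.
have := (ltn_ord i, ltn_ord j, ltn_ord r) => -[[i3 j3] r2].
rewrite yangian_pointE nth_mkseq; last by lia.
congr (x 0 (mxvec_index (mxvec_index _ _) _));
  by apply/val_inj; rewrite /= inordK; lia.
Qed.

Lemma polymap_yangian_point n (s : seq {mpoly k[n]}) v :
  polymap (yangian_point s) v = yangian_point [seq p.@[v] | p <- s].
Proof.
apply/rowP; case/mxvec_indexP => q r; case/mxvec_indexP: q => i j.
rewrite mxE !yangian_pointE; set m := (_ + _)%N.
have [ms|ms] := ltnP m (size s); first by rewrite (nth_map 0).
by rewrite !nth_default ?size_map ?meval0.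
Qed.

Lemma det3 (R : comNzRingType) (f : nat -> nat -> R) :
  \det (\matrix_(i < 3, j < 3) f i j) =
    f 0%N 0%N * (f 1%N 1%N * f 2%N 2%N - f 1%N 2%N * f 2%N 1%N)
    - f 0%N 1%N * (f 1%N 0%N * f 2%N 2%N - f 1%N 2%N * f 2%N 0%N)
    + f 0%N 2%N * (f 1%N 0%N * f 2%N 1%N - f 1%N 1%N * f 2%N 0%N).
Proof.
rewrite (expand_det_row _ ord0) !big_ord_recl big_ord0 /cofactor.
rewrite !(expand_det_row _ ord0) !big_ord_recl !big_ord0 /cofactor !det_mx11.
rewrite !mxE /= /bump /=; ring.
Qed.

Lemma det2 (R : comNzRingType) (f : nat -> nat -> R) :
  \det (\matrix_(i < 2, j < 2) f i j) =
    f 0%N 0%N * f 1%N 1%N - f 0%N 1%N * f 1%N 0%N.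
Proof.
rewrite (expand_det_row _ ord0) !big_ord_recl big_ord0 /cofactor !det_mx11.
rewrite !mxE /= /bump /=; ring.
Qed.

Definition yangian_entry (s : seq k) (i j : nat) : {poly k} :=
  (i == j)%:R * 'X^2 + (s`_(6 * i + 2 * j))%:P * 'X
  + (s`_(6 * i + 2 * j + 1))%:P.

Lemma meval_leading_minor (s : seq k) (m : 'I_3) :
  map_poly (meval (yangian_point s 0)) (leading_minor k 2 m) =
  \det (\matrix_(i < m.+1, j < m.+1) yangian_entry s i j).
Proof.
rewrite /leading_minor -det_map_mx; congr (\det _); apply/matrixP => i j.
rewrite !mxE rmorphD rmorphM /= rmorph_nat map_polyXn.
rewrite /yangian_entry -addrA; congr (_ + _).
rewrite rmorph_sum /= !big_ord_recl big_ord0 addr0.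
rewrite !rmorphM /= !map_polyXn !map_polyC /= !mevalXU !yangian_pointE /=.
by rewrite !addn0 expr0 mulr1 expr1.
Qed.

Lemma yangian_variety_coefP (s : seq k) :
  gelfand_tsetlin_variety k 3 2 (yangian_point s) <->
  forall m n : nat, (m < 3)%N -> (n < m.+1 * 2)%N ->
    (\det (\matrix_(i < m.+1, j < m.+1) yangian_entry s i j))`_n = 0.
Proof.
split=> [Vs m n m3 n2 | H f [m [j [/andP[j0 jm] ->]]]].
  rewrite -[m]/(val (Ordinal m3)) -meval_leading_minor coef_map /=.
  (* The coefficient of degree [n] is the [dbar] of index [m.+1 * 2 - n]; the bound on [n] leaves
     out the leading coefficient. *)
  have -> : n = (m.+1 * 2 - (m.+1 * 2 - n))%N by lia.
  apply: Vs; exists (Ordinal m3), (m.+1 * 2 - n)%N; split=> //=; lia.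
rewrite /dbar -coef_map meval_leading_minor.
by apply: H; [exact: ltn_ord | lia].
Qed.

Section Coordinates.

Variables a11 b11 a12 b12 a13 b13 a21 b21 a22 b22 a23 b23 : k.
Variables a31 b31 a32 b32 a33 b33 : k.

Let s : seq k := [:: a11; b11; a12; b12; a13; b13; a21; b21; a22; b22; a23; b23;
                     a31; b31; a32; b32; a33; b33].

(* The vanishing of the coefficients of $u^0, \dots, u^3$ in
   $\det (X_{ij}(u))$, given the conditions on the first two minors. *)
Definition cubic_relations : Prop :=
  [/\ a12 * a21 * (b31 * b13) = b12 * (b31 * b23) + b21 * (b32 * b13),
      a12 * a21 * (b31 * a13 + a31 * b13) =
        a12 * (b31 * b23) + b12 * (b31 * a23 + a31 * b23)
        + a21 * (b32 * b13) + b21 * (b32 * a13 + a32 * b13),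
      b31 * b13 + b32 * b23 + a12 * a21 * (a31 * a13) =
        a12 * (b31 * a23 + a31 * b23) + b12 * (a31 * a23)
        + a21 * (b32 * a13 + a32 * b13) + b21 * (a32 * a13)
    & b31 * a13 + a31 * b13 + b32 * a23 + a32 * b23 =
        a12 * (a31 * a23) + a21 * (a32 * a13)].

Lemma minor1E : \det (\matrix_(i < 1, j < 1) yangian_entry s i j) =
  Poly [:: b11; a11; 1].
Proof.
rewrite det_mx11 mxE /yangian_entry /= !cons_poly_def; ring.
Qed.

Lemma minor2E : a11 = 0 -> b11 = 0 ->
  \det (\matrix_(i < 2, j < 2) yangian_entry s i j) =
  Poly [:: - (b12 * b21); - (a12 * b21 + b12 * a21); b22 - a12 * a21; a22; 1].
Proof.
move=> a11_0 b11_0; rewrite det2 /yangian_entry /= a11_0 b11_0 !cons_poly_def.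
ring.
Qed.

Lemma minor3E :
  a11 = 0 -> b11 = 0 -> a22 = 0 -> b22 = a12 * a21 ->
  b12 * b21 = 0 -> a12 * b21 + b12 * a21 = 0 ->
  \det (\matrix_(i < 3, j < 3) yangian_entry s i j) =
  Poly [:: b12 * (b31 * b23) + b21 * (b32 * b13) - a12 * a21 * (b31 * b13);
           a12 * (b31 * b23) + b12 * (b31 * a23 + a31 * b23)
             + a21 * (b32 * b13) + b21 * (b32 * a13 + a32 * b13)
             - a12 * a21 * (b31 * a13 + a31 * b13);
           a12 * (b31 * a23 + a31 * b23) + b12 * (a31 * a23)
             + a21 * (b32 * a13 + a32 * b13) + b21 * (a32 * a13)
             - (b31 * b13 + b32 * b23 + a12 * a21 * (a31 * a13));
           a12 * (a31 * a23) + a21 * (a32 * a13)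
             - (b31 * a13 + a31 * b13 + b32 * a23 + a32 * b23);
           b33 - (a31 * a13 + a32 * a23); a33; 1].
Proof.
move=> a11_0 b11_0 a22_0 b22E e0 e1.
set rhs := Poly _.
(* Restoring the part of [X_12 X_21] killed by [e0] and [e1], multiplied by [X_33], leaves a
   polynomial identity for [ring]. *)
transitivity (rhs - ((a12 * b21 + b12 * a21)%:P * 'X + (b12 * b21)%:P)
                    * ('X^2 + a33%:P * 'X + b33%:P)); last first.
  by rewrite e0 e1 mul0r add0r mul0r subr0.
rewrite det3 /yangian_entry /rhs /= a11_0 b11_0 a22_0 b22E !cons_poly_def.
ring.
Qed.

Lemma yangian_varietyP :
  gelfand_tsetlin_variety k 3 2 (yangian_point s) <->
  [/\ a11 = 0 /\ b11 = 0,
      a22 = 0 /\ b22 = a12 * a21,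
      b12 * b21 = 0 /\ a12 * b21 + b12 * a21 = 0,
      a33 = 0 /\ b33 = a31 * a13 + a32 * a23
    & cubic_relations].
Proof.
rewrite yangian_variety_coefP; split.
  move=> H.
  have H1 n := H 0%N n isT; rewrite minor1E in H1.
  have := (H1 0%N isT, H1 1%N isT); rewrite !coef_Poly /= => -[b11_0 a11_0].
  have H2 n := H 1%N n isT; rewrite minor2E // in H2.
  have := (H2 0%N isT, H2 1%N isT, H2 2%N isT, H2 3%N isT).
  rewrite !coef_Poly /= => -[[[/eqP e0 /eqP e1] /subr0_eq b22E] a22_0].
  rewrite !oppr_eq0 in e0 e1; move/eqP: e0 => e0; move/eqP: e1 => e1.
  have H3 n := H 2%N n isT; rewrite minor3E // in H3.
  have := (H3 0%N isT, H3 1%N isT, H3 2%N isT,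
           H3 3%N isT, H3 4%N isT, H3 5%N isT).
  rewrite !coef_Poly /= => -[[[[[/subr0_eq c0 /subr0_eq c1] /subr0_eq c2]
    /subr0_eq c3] /subr0_eq c4] c5].
  by split=> //; split.
move=> [[a11_0 b11_0] [a22_0 b22E] [e0 e1] [a33_0 b33E] [c0 c1 c2 c3]] m n m3.
case: m m3 => [|[|[|//]]] _ n2.
- by rewrite minor1E coef_Poly; do 2![case: n n2 => [|n] //= n2].
- rewrite minor2E // coef_Poly e0 e1 b22E subrr a22_0 oppr0.
  by do 4![case: n n2 => [|n] //= n2].
- rewrite minor3E // coef_Poly a33_0 b33E c0 c1 c2 c3 !subrr.
  by do 6![case: n n2 => [|n] //= n2].
Qed.

End Coordinates.

(** * The strata *)

(** Certificate format for the strata: an equation is a multiple [c] of a known relation, and [ring]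
    or [field] checks the identity. *)
Lemma linear_combination (R : pzRingType) (c l r a b : R) :
  l = r -> a - b = c * (l - r) -> a = b.
Proof. by move=> -> E; apply: subr0_eq; rewrite E subrr mulr0. Qed.

Section Strata.

Variables a c x1 x0 y1 y0 z1 z0 w1 w0 : k.

(** The relations read [(w0 - a * z1) * (y0 - c * x1) = 0] and [(w0 - a * z1) * y1 + w1 * (y0 - c *
    x1) = 0]. *)
Lemma stratum_x0_z0_eq0 :
  w0 * y0 + a * c * (z1 * x1) = a * (z1 * y0) + c * (w0 * x1) ->
  w0 * y1 + w1 * y0 = a * (z1 * y1) + c * (w1 * x1) ->
  [\/ y0 = c * x1 /\ w0 = a * z1,
      y0 = c * x1 /\ y1 = 0
    | w0 = a * z1 /\ w1 = 0].
Proof.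
move=> r2 r3.
have /eqP : (w0 - a * z1) * (y0 - c * x1) = 0.
  by apply: (linear_combination (c := 1) r2); ring.
rewrite mulf_eq0 !subr_eq0 => /orP[/eqP W|/eqP Y].
  have /eqP : w1 * (y0 - c * x1) = 0.
    by apply: (linear_combination (c := 1) r3); rewrite W; ring.
  rewrite mulf_eq0 subr_eq0 => /orP[/eqP w1_0|/eqP Y].
    by constructor 3.
  by constructor 1.
have /eqP : y1 * (w0 - a * z1) = 0.
  by apply: (linear_combination (c := 1) r3); rewrite Y; ring.
by rewrite mulf_eq0 subr_eq0 => /orP[/eqP|/eqP]; [constructor 2|constructor 1].
Qed.

(** If [c != 0], the relations force in turn [w0 = a * z1], [w1 = 0] and [z1 = 0]. If [c = 0], they
    give [(w0 - a * z1) * y0 = 0] and a formula for [z1 * x0]; the parameter [v] is [y0 / x0] or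
    [(a * z1 - w0) / x0]. *)
Lemma stratum_x0_neq0_z0_eq0 :
  x0 != 0 ->
  a * c * (z1 * x0) = c * (w0 * x0) ->
  w0 * y0 + a * c * (z1 * x1) = a * (z1 * y0) + c * (w0 * x1 + w1 * x0) ->
  z1 * x0 + w0 * y1 + w1 * y0 = a * (z1 * y1) + c * (w1 * x1) ->
  [\/ [/\ z1 = 0, w1 = 0 & w0 = 0],
      [/\ c = 0, y0 = 0 & exists v, z1 = v * y1 /\ w0 = a * v * y1 - x0 * v]
    | c = 0 /\
      exists v, [/\ y0 = x0 * v, z1 = - (v * w1) & w0 = - (a * v * w1)]].
Proof.
move=> x0N0 r1 r2 r3.
have [c0|cN0] := eqVneq c 0; last first.
  have W : w0 = a * z1.
    apply: (mulIf x0N0); apply: (mulfI cN0).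
    by apply: (linear_combination (c := -1) r1); ring.
  have w1_0 : w1 = 0.
    apply: (mulIf x0N0); apply: (mulfI cN0).
    by apply: (linear_combination (c := -1) r2); rewrite W; ring.
  have z1_0 : z1 = 0.
    apply: (mulIf x0N0).
    by apply: (linear_combination (c := 1) r3); rewrite W w1_0; ring.
  by constructor 1; rewrite W z1_0 mulr0.
rewrite {}c0 in r1 r2 r3 *.
have /eqP : (w0 - a * z1) * y0 = 0.
  by apply: (linear_combination (c := 1) r2); ring.
rewrite mulf_eq0 subr_eq0 => /orP[/eqP W|/eqP Y].
  have z1E : z1 = - (y0 / x0 * w1).
    apply: (linear_combination (c := x0^-1) r3); rewrite W; by field.
  constructor 3; split=> //; exists (y0 / x0); split=> //; first by field.
  by rewrite W z1E; ring.
have z1E : z1 = (a * z1 - w0) / x0 * y1.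
  apply: (linear_combination (c := x0^-1) r3); rewrite Y; by field.
constructor 2; split=> //; exists ((a * z1 - w0) / x0); split=> //.
apply: (linear_combination (c := a) z1E); by field.
Qed.

Lemma stratum_a_eq0_c_neq0 :
  x0 != 0 -> c != 0 ->
  0 = c * (w0 * x0) ->
  z0 * x0 + w0 * y0 = c * (w0 * x1 + w1 * x0) ->
  z0 * x1 + z1 * x0 + w0 * y1 + w1 * y0 = c * (w1 * x1) ->
  w0 = 0 /\ exists v, [/\ w1 = x0 * v, z0 = c * x0 * v & z1 = - (v * y0)].
Proof.
move=> x0N0 cN0 r1 r2 r3.
have W : w0 = 0.
  apply: (mulIf x0N0); apply: (mulfI cN0).
  by apply: (linear_combination (c := -1) r1); ring.
have z0E : z0 = c * w1.
  apply: (mulIf x0N0).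
  by apply: (linear_combination (c := 1) r2); rewrite W; ring.
split=> //; exists (w1 / x0); split; first by field.
  by rewrite z0E; field.
by apply: (linear_combination (c := x0^-1) r3); rewrite W z0E; field.
Qed.

(** As [x0 != 0], the polynomial [x = x1 t + x0] is a unit modulo [t^2]. The parameters are the
    coefficients of the quotient [y / x = u + v t], and the relations, which say [z x + w y = 0]
    modulo [t^2], give [z = -(u + v t) w]. *)
Lemma stratum_a_c_eq0 :
  x0 != 0 ->
  z0 * x0 + w0 * y0 = 0 ->
  z0 * x1 + z1 * x0 + w0 * y1 + w1 * y0 = 0 ->
  exists u v, [/\ y0 = x0 * u, y1 = x0 * v + x1 * u,
                  z0 = - (u * w0) & z1 = - (u * w1) - v * w0].
Proof.
move=> x0N0 r2 r3.
have z0E : z0 = - (y0 / x0 * w0).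
  by apply: (linear_combination (c := x0^-1) r2); field.
exists (y0 / x0), ((y1 - x1 * (y0 / x0)) / x0); split=> //; try by field.
apply: (linear_combination (c := x0^-1) r3); rewrite z0E; by field.
Qed.

(** As [d != 0], the first two relations say that the product of [w1 t + w0] and [x1 t + x0]
    vanishes modulo [t^2]. So one factor is zero or both constant terms are, and the other relations
    split these cases into the five listed. *)
Lemma stratum_d_neq0 (d : k) :
  d != 0 ->
  0 = d * (w0 * x0) ->
  0 = c * (w0 * x0) + d * (w0 * x1 + w1 * x0) ->
  z0 * x0 + w0 * y0 = c * (w0 * x1 + w1 * x0) + d * (w1 * x1) ->
  z0 * x1 + z1 * x0 + w0 * y1 + w1 * y0 = c * (w1 * x1) ->
  [\/ [/\ x0 = 0, x1 = 0, w0 = 0 & w1 = 0],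
      [/\ x0 = 0, x1 = 0, w0 = 0 & y0 = 0],
      [/\ x0 = 0, w0 = 0, w1 = 0 & z0 = 0]
    | [/\ x0 = 0, x1 = 0, y0 = 0 & y1 = 0] \/
      [/\ w0 = 0, w1 = 0, z0 = 0 & z1 = 0]].
Proof.
move=> dN0 r0 r1 r2 r3.
have wx0 : w0 * x0 = 0.
  by apply: (mulfI dN0); apply: (linear_combination (c := -1) r0); ring.
have wx1 : w0 * x1 + w1 * x0 = 0.
  apply: (mulfI dN0); apply: (linear_combination (c := -1) r1).
  by rewrite wx0; ring.
have zw : z0 * x0 + w0 * y0 = d * (w1 * x1).
  by rewrite r2 wx1 mulr0 add0r.
have [x0_0|x0N0] := eqVneq x0 0.
  have [w0_0|w0N0] := eqVneq w0 0.
    have /eqP : w1 * x1 = 0.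
      apply: (mulfI dN0); apply: (linear_combination (c := -1) zw).
      by rewrite x0_0 w0_0; ring.
    rewrite mulf_eq0 => /orP[/eqP w1_0|/eqP x1_0].
      have /eqP : z0 * x1 = 0.
        apply: (linear_combination (c := 1) r3).
        by rewrite x0_0 w0_0 w1_0; ring.
      by rewrite mulf_eq0 => /orP[/eqP|/eqP]; [constructor 3|constructor 1].
    have /eqP : w1 * y0 = 0.
      apply: (linear_combination (c := 1) r3).
      by rewrite x0_0 w0_0 x1_0; ring.
    by rewrite mulf_eq0 => /orP[/eqP|/eqP]; [constructor 1|constructor 2].
  have x1_0 : x1 = 0.
    apply: (mulfI w0N0); apply: (linear_combination (c := 1) wx1).
    by rewrite x0_0; ring.
  have y0_0 : y0 = 0.
    apply: (mulfI w0N0); apply: (linear_combination (c := 1) zw).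
    by rewrite x0_0 x1_0; ring.
  have y1_0 : y1 = 0.
    apply: (mulfI w0N0); apply: (linear_combination (c := 1) r3).
    by rewrite x0_0 x1_0 y0_0; ring.
  by constructor 4; left.
have w0_0 : w0 = 0.
  by apply: (mulIf x0N0); rewrite wx0 mul0r.
have w1_0 : w1 = 0.
  apply: (mulIf x0N0); apply: (linear_combination (c := 1) wx1).
  by rewrite w0_0; ring.
have z0_0 : z0 = 0.
  apply: (mulIf x0N0); apply: (linear_combination (c := 1) zw).
  by rewrite w0_0 w1_0; ring.
have z1_0 : z1 = 0.
  apply: (mulIf x0N0); apply: (linear_combination (c := 1) r3).
  by rewrite w0_0 w1_0 z0_0; ring.
by constructor 4; right.
Qed.

End Strata.

(** * The parametrized families and their union *)

Section Families.

Variable R : comNzRingType.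

(* X_12 = a u + b, X_21 = c u + d, X_13 = x1 u + x0, X_23 = y1 u + y0,
   X_31 = z1 u + z0, X_32 = w1 u + w0. *)
Definition gt_point (a b c d x1 x0 y1 y0 z1 z0 w1 w0 : R) : seq R :=
  [:: 0; 0; a; b; x1; x0; c; d; 0; a * c; y1; y0;
      z1; z0; w1; w0; 0; z1 * x1 + w1 * y1].

(* The variety is the union of the images of these maps. The order of the
   parameters matters only for [flag_strict]. *)
Definition gt_families (t0 t1 t2 t3 t4 t5 : R) : seq (seq R) :=
  [:: gt_point t0 0 t1 0 t2 0 t4 (t1 * t2) t3 0 t5 (t0 * t3);
      gt_point t0 0 t1 0 t2 0 0 (t1 * t2) t3 0 t4 t5;
      gt_point t0 0 t1 0 t2 0 t4 t5 t3 0 0 (t0 * t3);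
      gt_point t0 0 t1 0 t2 t3 t4 t5 0 0 0 0;
      gt_point t2 0 0 0 t3 t0 t4 0 (t1 * t4) 0 t5 (t2 * t1 * t4 - t0 * t1);
      gt_point t2 0 0 0 t3 t0 t4 (t0 * t1)
        (- (t1 * t5)) 0 t5 (- (t2 * t1 * t5));
      gt_point t0 0 t1 0 0 0 0 0 t2 t3 t4 t5;
      gt_point 0 0 t2 0 (t1 * t4) 0 t5 (t2 * t1 * t4 - t0 * t1) t3 t0 t4 0;
      gt_point 0 0 t2 0 (- (t1 * t5)) 0 t5 (- (t2 * t1 * t5))
        t3 t0 t4 (t0 * t1);
      gt_point 0 0 0 0 t3 t0 (t0 * t2 + t3 * t1) (t0 * t1)
        (- (t1 * t5) - t2 * t4) (- (t1 * t4)) t5 t4;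
      gt_point 0 0 t2 0 t3 t0 t5 t4 (- (t1 * t4)) (t2 * t0 * t1) (t0 * t1) 0;
      gt_point t2 0 0 0 (- (t1 * t4)) (t2 * t0 * t1) (t0 * t1) 0 t3 t0 t5 t4;
      gt_point 0 0 t0 t1 0 0 t2 t3 t4 t5 0 0;
      gt_point 0 0 t0 t1 0 0 t2 0 t4 t5 t3 0;
      gt_point 0 0 t0 t1 t2 0 t3 t4 t5 0 0 0;
      gt_point 0 0 t0 t1 0 0 0 0 t2 t3 t4 t5;
      gt_point 0 0 t0 t1 t2 t3 t4 t5 0 0 0 0;
      gt_point t0 t1 0 0 t4 t5 0 0 0 0 t2 t3;
      gt_point t0 t1 0 0 t4 t5 t3 0 0 0 t2 0;
      gt_point t0 t1 0 0 t5 0 0 0 t2 0 t3 t4;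
      gt_point t0 t1 0 0 t2 t3 t4 t5 0 0 0 0;
      gt_point t0 t1 0 0 0 0 0 0 t2 t3 t4 t5].

End Families.

Lemma gt_point_varietyP (a b c d x1 x0 y1 y0 z1 z0 w1 w0 : k) :
  gelfand_tsetlin_variety k 3 2
    (yangian_point (gt_point a b c d x1 x0 y1 y0 z1 z0 w1 w0)) <->
  [/\ b * d = 0, a * d + b * c = 0
    & cubic_relations a b x1 x0 c d y1 y0 z1 z0 w1 w0].
Proof. by rewrite yangian_varietyP; split=> [[_ _ [? ?] _ ?]|[? ? ?]]. Qed.

Lemma yangian_variety_gt_point x :
  gelfand_tsetlin_variety k 3 2 x ->
  exists a b c d x1 x0 y1 y0 z1 z0 w1 w0,
    x = yangian_point (gt_point a b c d x1 x0 y1 y0 z1 z0 w1 w0).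
Proof.
have [s s18 ->] := yangian_point_surj x.
do 18![case: s s18 => [//|? s] s18]; case: s s18 => // _.
move=> /yangian_varietyP [[-> ->] [-> ->] _ [-> ->] _].
by do 12!eexists.
Qed.

Lemma gt_families_sub_variety (t0 t1 t2 t3 t4 t5 : k) s :
  s \in gt_families t0 t1 t2 t3 t4 t5 ->
  gelfand_tsetlin_variety k 3 2 (yangian_point s).
Proof.
move=> sP; repeat (move: sP; rewrite in_cons => /orP[/eqP -> {s}|sP] //;
  first by apply/gt_point_varietyP; split; [ring|ring|split; ring]).
Qed.

(** Splits on the vanishing of [d], [b], [x0], [z0], [a], [c]. Transposition exchanges [a], [b] with
    [c], [d], the [x] with the [z] and the [y] with the [w], so three of the stratum lemmas serve
    twice, the second time with permuted arguments. *)
Lemma gt_families_cover (a b c d x1 x0 y1 y0 z1 z0 w1 w0 : k) :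
  b * d = 0 -> a * d + b * c = 0 ->
  cubic_relations a b x1 x0 c d y1 y0 z1 z0 w1 w0 ->
  exists t0 t1 t2 t3 t4 t5,
    gt_point a b c d x1 x0 y1 y0 z1 z0 w1 w0
      \in gt_families t0 t1 t2 t3 t4 t5.
Proof.
(* [H] lets each case end by naming the index of a family and its six parameters. *)
move=> bd; suff H : forall i t0 t1 t2 t3 t4 t5, (i < 22)%N ->
    gt_point a b c d x1 x0 y1 y0 z1 z0 w1 w0 =
      nth [::] (gt_families t0 t1 t2 t3 t4 t5) i ->
    exists t0 t1 t2 t3 t4 t5, gt_point a b c d x1 x0 y1 y0 z1 z0 w1 w0
      \in gt_families t0 t1 t2 t3 t4 t5; last first.
  move=> i t0 t1 t2 t3 t4 t5 i22 ->; exists t0, t1, t2, t3, t4, t5.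
  exact: mem_nth.
move=> adbc [r0 r1 r2 r3].
have [d0|dN0] := eqVneq d 0; last first.
  have b0 : b = 0 by apply: (mulIf dN0); rewrite bd mul0r.
  have a0 : a = 0.
    apply: (mulIf dN0); apply: (linear_combination (c := 1) adbc).
    by rewrite b0; ring.
  subst a b; rewrite !mul0r ?add0r ?addr0 in r0 r1 r2 r3.
  have := stratum_d_neq0 dN0 r0 r1 r2 r3.
  case=> [[e1 e2 e3 e4]|[e1 e2 e3 e4]|[e1 e2 e3 e4]|
    [[e1 e2 e3 e4]|[e1 e2 e3 e4]]]; rewrite e1 e2 e3 e4 in H *.
  - exact: (H 12%N c d y1 y0 z1 z0).
  - exact: (H 13%N c d y1 w1 z1 z0).
  - exact: (H 14%N c d x1 y1 y0 z1).
  - exact: (H 15%N c d z1 z0 w1 w0).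
  - exact: (H 16%N c d x1 x0 y1 y0).
have [b0|bN0] := eqVneq b 0; last first.
  have c0 : c = 0.
    apply: (mulfI bN0); apply: (linear_combination (c := 1) adbc).
    by rewrite d0; ring.
  subst c d.
  have [||||[e1 e2 e3 e4]|[e1 e2 e3 e4]|[e1 e2 e3 e4]|
      [[e1 e2 e3 e4]|[e1 e2 e3 e4]]] :=
      @stratum_d_neq0 a z1 z0 w1 w0 x1 x0 y1 y0 b bN0.
  - by apply: (linear_combination (c := 1) r0); ring.
  - by apply: (linear_combination (c := 1) r1); ring.
  - by apply: (linear_combination (c := 1) r2); ring.
  - by apply: (linear_combination (c := 1) r3); ring.
  1-5: rewrite e1 e2 e3 e4 in H *.
  - exact: (H 17%N a b w1 w0 x1 x0).
  - exact: (H 18%N a b w1 y1 x1 x0).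
  - exact: (H 19%N a b z1 w1 w0 x1).
  - exact: (H 20%N a b x1 x0 y1 y0).
  - exact: (H 21%N a b z1 z0 w1 w0).
subst b d.
have [x0_0|x0N0] := eqVneq x0 0; have [z0_0|z0N0] := eqVneq z0 0.
- subst x0 z0.
  have [||[e1 e2]|[e1 e2]|[e1 e2]] := @stratum_x0_z0_eq0 a c x1 y1 y0 z1 w1 w0.
  + by apply: (linear_combination (c := 1) r2); ring.
  + by apply: (linear_combination (c := 1) r3); ring.
  1-3: rewrite e1 e2 in H *.
  + exact: (H 0%N a c x1 z1 y1 w1).
  + exact: (H 1%N a c x1 z1 w1 w0).
  + exact: (H 2%N a c x1 z1 y1 y0).
- subst x0.
  have [|||[e1 e2 e3]|[e1 e2 [v [e3 e4]]]|[e1 [v [e2 e3 e4]]]] :=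
    @stratum_x0_neq0_z0_eq0 c a z1 z0 w1 w0 x1 y1 y0 z0N0.
  + by apply: (linear_combination (c := 1) r1); ring.
  + by apply: (linear_combination (c := 1) r2); ring.
  + by apply: (linear_combination (c := 1) r3); ring.
  + by rewrite e1 e2 e3 in H *; apply: (H 6%N a c z1 z0 w1 w0).
  + by rewrite e1 e2 e3 e4 in H *; apply: (H 7%N z0 v c z1 w1 y1).
  + by rewrite e1 e2 e3 e4 in H *; apply: (H 8%N z0 v c z1 w1 y1).
- subst z0.
  have [|||[e1 e2 e3]|[e1 e2 [v [e3 e4]]]|[e1 [v [e2 e3 e4]]]] :=
    @stratum_x0_neq0_z0_eq0 a c x1 x0 y1 y0 z1 w1 w0 x0N0.
  + by apply: (linear_combination (c := 1) r1); ring.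
  + by apply: (linear_combination (c := 1) r2); ring.
  + by apply: (linear_combination (c := 1) r3); ring.
  + by rewrite e1 e2 e3 in H *; apply: (H 3%N a c x1 x0 y1 y0).
  + by rewrite e1 e2 e3 e4 in H *; apply: (H 4%N x0 v a x1 y1 w1).
  + by rewrite e1 e2 e3 e4 in H *; apply: (H 5%N x0 v a x1 y1 w1).
have /eqP : a * c = 0.
  apply: (mulIf x0N0); apply: (mulIf z0N0).
  by apply: (linear_combination (c := 1) r0); ring.
have [a0 _|aN0] := eqVneq a 0; last first.
  rewrite mulf_eq0 (negPf aN0) /= => /eqP c0; subst c.
  have [||| e1 [v [e2 e3 e4]]] :=
    @stratum_a_eq0_c_neq0 a z1 z0 w1 w0 x1 x0 y1 y0 z0N0 aN0.
  + by apply: (linear_combination (c := 1) r1); ring.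
  + by apply: (linear_combination (c := 1) r2); ring.
  + by apply: (linear_combination (c := 1) r3); ring.
  apply: (H 11%N z0 v a z1 w0 w1) => //=.
  by rewrite e1 e2 e3 e4.
subst a; have [c0|cN0] := eqVneq c 0; last first.
  have [||| e1 [v [e2 e3 e4]]] :=
    @stratum_a_eq0_c_neq0 c x1 x0 y1 y0 z1 z0 w1 w0 x0N0 cN0.
  + by apply: (linear_combination (c := 1) r1); ring.
  + by apply: (linear_combination (c := 1) r2); ring.
  + by apply: (linear_combination (c := 1) r3); ring.
  apply: (H 10%N x0 v c x1 y0 y1) => //=.
  by rewrite e1 e2 e3 e4.
subst c; have [||u [v [e1 e2 e3 e4]]] :=
  @stratum_a_c_eq0 x1 x0 y1 y0 z1 z0 w1 w0 x0N0.
- by apply: (linear_combination (c := 1) r2); ring.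
- by apply: (linear_combination (c := 1) r3); ring.
apply: (H 9%N x0 u v x1 w0 w1) => //=.
by rewrite e1 e2 e3 e4.
Qed.

(** * Strictness of the flags and the dimension of the variety *)

Lemma map_gt_families (R S : comNzRingType) (f : {rmorphism R -> S})
    (t0 t1 t2 t3 t4 t5 : R) :
  [seq map f s | s <- gt_families t0 t1 t2 t3 t4 t5] =
  gt_families (f t0) (f t1) (f t2) (f t3) (f t4) (f t5).
Proof.
rewrite /gt_families /gt_point /=.
by rewrite !(rmorphB, rmorphD, rmorphN, rmorphM, rmorph0).
Qed.

(* Row i, entry j: a coordinate of the i-th family that vanishes when t_j and
   the later parameters do, but not when only the later ones do. *)
Definition gt_pivots : seq (seq nat) :=
  [:: [:: 2; 6; 4; 12; 10; 14]; [:: 2; 6; 4; 12; 14; 15];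
      [:: 2; 6; 4; 12; 10; 11]; [:: 2; 6; 4; 5; 10; 11];
      [:: 5; 15; 2; 4; 10; 14]; [:: 5; 11; 2; 4; 10; 14];
      [:: 2; 6; 12; 13; 14; 15]; [:: 13; 11; 6; 12; 14; 10];
      [:: 13; 15; 6; 12; 14; 10]; [:: 5; 11; 10; 4; 15; 14];
      [:: 5; 14; 6; 4; 11; 10]; [:: 13; 10; 2; 12; 15; 14];
      [:: 6; 7; 10; 11; 12; 13]; [:: 6; 7; 10; 14; 12; 13];
      [:: 6; 7; 4; 10; 11; 12]; [:: 6; 7; 12; 13; 14; 15];
      [:: 6; 7; 4; 5; 10; 11]; [:: 2; 3; 14; 15; 4; 5];
      [:: 2; 3; 14; 10; 4; 5]; [:: 2; 3; 12; 14; 15; 4];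
      [:: 2; 3; 4; 5; 10; 11]; [:: 2; 3; 12; 13; 14; 15]]%N.

Lemma gt_pivot_bound i j : (nth 0 (nth [::] gt_pivots i) j < 18)%N.
Proof.
have /all_nthP pi : all (all (fun m => m < 18)%N) gt_pivots by [].
have [i22|i22] := ltnP i (size gt_pivots); last first.
  by rewrite [nth [::] _ _]nth_default // nth_nil.
have [j6|j6] := ltnP j (size (nth [::] gt_pivots i)); last first.
  by rewrite nth_default.
exact: (all_nthP 0%N (pi [::] i i22)).
Qed.

Lemma gt_families_pivot_eq0 (i j : nat) (t : nat -> k) :
  (i < 22)%N -> (j < 6)%N -> (forall l, (j <= l)%N -> t l = 0) ->
  (nth [::] (gt_families (t 0%N) (t 1%N) (t 2%N) (t 3%N) (t 4%N) (t 5%N)) i)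
    `_(nth 0%N (nth [::] gt_pivots i) j) = 0.
Proof.
move=> i22 j6 t0; have simp := (mulr0, mul0r, addr0, subr0, oppr0).
case: j j6 t0 => [|[|[|[|[|[|//]]]]]] _ t0.
all: do 22![case: i i22 => [|i] i22; first by rewrite /=;
  try rewrite (t0 5%N isT); try rewrite (t0 4%N isT); try rewrite (t0 3%N isT);
  try rewrite (t0 2%N isT); try rewrite (t0 1%N isT); try rewrite (t0 0%N isT);
  rewrite ?simp].
all: by [].
Qed.

(** At this point, with entries 0 and 1, the pivot equals 1 or -1. *)
Lemma gt_families_pivot_neq0 (i j : nat) (t : nat -> k) :
  (i < 22)%N -> (j < 6)%N -> (forall l, t l = (l <= j)%:R) ->
  (nth [::] (gt_families (t 0%N) (t 1%N) (t 2%N) (t 3%N) (t 4%N) (t 5%N)) i)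
    `_(nth 0%N (nth [::] gt_pivots i) j) != 0.
Proof.
have simp := (mulr0, mul0r, addr0, add0r, sub0r, mulr1, oppr_eq0, oner_eq0).
move=> i22 j6 t_le; rewrite !{}t_le.
case: j j6 => [|[|[|[|[|[|//]]]]]] _.
all: do 22![case: i i22 => [|i] i22; first by rewrite /= ?simp].
all: by [].
Qed.

(** The separating function is a single coordinate ['X_q], where [q] decodes the flat position
    [m]. *)
Lemma flag_strict_yangian_point (s : seq {mpoly k[6]}) :
  (forall j, (j < 6)%N -> exists2 m, (m < 18)%N &
    (forall v : 'I_6 -> k, flag 6 j v -> (s`_m).@[v] = 0) /\
    (exists2 v : 'I_6 -> k, flag 6 j.+1 v & (s`_m).@[v] != 0)) ->
  flag_strict (yangian_point s).
Proof.
move=> sP j j6; have [m m18 [m0 [w fw mw]]] := sP j j6.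
pose q := mxvec_index (mxvec_index (inord (m %/ 6) : 'I_3)
  (inord (m %% 6 %/ 2) : 'I_3)) (inord (m %% 2) : 'I_2).
have qE (v : 'I_6 -> k) : ('X_q).@[polymap (yangian_point s) v 0] = (s`_m).@[v].
  rewrite mevalXU mxE yangian_pointE !inordK; [|lia..].
  by congr (s`_ _).@[v]; lia.
exists 'X_q; first by move=> _ [v /m0 v0 <-]; rewrite qE.
by move=> f0; case/eqP: mw; rewrite -qE; apply: f0; exists w.
Qed.

(** The families make sense over any commutative ring: at the six variables they give maps, at
    scalars they give points, and [map_gt_families] links the two through evaluation. *)
Definition gt_maps : seq 'rV[{mpoly k[6]}]_(3 * 3 * 2) :=
  let X (i : nat) := 'X_(inord i : 'I_6) in
  map (yangian_point (V := {mpoly k[6]}))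
    (gt_families (X 0%N) (X 1%N) (X 2%N) (X 3%N) (X 4%N) (X 5%N)).

Lemma gt_maps_image v :
  [seq polymap phi v | phi <- gt_maps] =
  map (@yangian_point k)
    (gt_families (v (inord 0)) (v (inord 1)) (v (inord 2))
                 (v (inord 3)) (v (inord 4)) (v (inord 5))).
Proof.
rewrite -!(mevalXU v) -(map_gt_families (meval v)) -!map_comp.
by apply: eq_map => s /=; rewrite polymap_yangian_point.
Qed.

Lemma gt_maps_strict phi : phi \in gt_maps -> flag_strict phi.
Proof.
case/(nthP 0) => i; rewrite size_map => i22 <-; rewrite (nth_map [::]) //.
set s := nth _ _ _.
have sE v m : (s`_m).@[v] = (nth [::] (gt_families (v (inord 0)) (v (inord 1))
    (v (inord 2)) (v (inord 3)) (v (inord 4)) (v (inord 5))) i)`_m.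
  rewrite -!(mevalXU v) -(map_gt_families (meval v)) (nth_map [::]) // -/s.
  have [ms|ms] := ltnP m (size s); first by rewrite (nth_map 0).
  by rewrite (nth_default _ ms) nth_default ?size_map // meval0.
apply: flag_strict_yangian_point => j j6.
exists (nth 0%N (nth [::] gt_pivots i) j).
  exact: gt_pivot_bound.
split=> [v vj|].
  (* Indices from 6 on get the value 0, as the pivot lemma takes a sequence indexed by [nat]. *)
  rewrite sE; pose t l := if (l < 6)%N then v (inord l) else 0.
  apply: (gt_families_pivot_eq0 (t := t)) => // l jl.
  by rewrite /t; case: ifP => // l6; apply: vj; rewrite inordK.
exists (fun l => (l <= j)%:R); first by move=> l; rewrite ltnNge => /negPf ->.
rewrite sE !inordK //.
exact: (gt_families_pivot_neq0 (t := fun l => (l <= j)%:R)).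
Qed.

Lemma yangian_variety_dimension :
  equidimensional (gelfand_tsetlin_variety k 3 2) /\
  has_dimension (gelfand_tsetlin_variety k 3 2) 6.
Proof.
apply: (equidimensional_of_images (L := gt_maps)) => //.
- by eexists.
- move=> phi phiL; split; first exact: gt_maps_strict.
  move=> _ [v _ <-]; have := map_f (fun phi => polymap phi v) phiL.
  rewrite gt_maps_image => /mapP [s sP ->].
  exact: gt_families_sub_variety sP.
move=> x Gx.
have [a [b [c [d [x1 [x0 [y1 [y0 [z1 [z0 [w1 [w0 xE]]]]]]]]]]]] :=
  yangian_variety_gt_point Gx.
move: Gx; rewrite {}xE => /gt_point_varietyP [bd adbc rel].
have [t0 [t1 [t2 [t3 [t4 [t5 sP]]]]]] := gt_families_cover bd adbc rel.
pose v (i : 'I_6) := nth 0 [:: t0; t1; t2; t3; t4; t5] i.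
have : yangian_point (gt_point a b c d x1 x0 y1 y0 z1 z0 w1 w0)
    \in [seq polymap phi v | phi <- gt_maps].
  rewrite gt_maps_image /v !inordK //; exact: map_f.
by move=> /mapP [phi phiL ->]; exists phi => //; exists v.
Qed.

End GelfandTsetlin.

Theorem proposition4p13 (k : closedFieldType) (char0 : [pchar k] =i pred0) :
  equidimensional (gelfand_tsetlin_variety k 3 2) /\
  has_dimension (gelfand_tsetlin_variety k 3 2) 6.
Proof. exact: yangian_variety_dimension. Qed.
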